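(* Let $T$ be a tournament on $n$ vertices. If $n$ is odd, there is a set of $n$ dice $X_1,\dots,X_n$, each with $n$ sides, that realizes $T$. If $n$ is divisible by $4$, there is a set of $n$ dice $X_1,\dots,X_n$, each with $n+1$ sides, that realizes $T$. If $n$ is even and not divisible by $4$, there is a set of $n$ dice $X_1,\dots,X_n$, each with $n-1$ sides, that realizes $T$.
   Context: A tournament on $n$ vertices is a directed graph on the vertex set $\{1,2,\dots,n\}$ such that for every pair of distinct vertices $i,j$ there is either an edge from $i$ to $j$ or an edge from $j$ to $i$, but not both (and there are no loops). A die with $k$ sides is a list of $k$ numbers (its faces); rolling it yields each of its $k$ faces with probability $1/k$, and different dice are rolled independently. Thus for two $k$-sided dice $X$ and $X'$, the probability that $X$ rolls a higher number than $X'$ is the number of ordered pairs ($a$ a face of $X$, $b$ a face of $X'$) with $a>b$, divided by $k^2$. Write $X_i \succeq X_j$ if the probability that $X_i$ rolls a higher number than $X_j$ is greater than $1/2$. A set of dice $X_1,\dots,X_n$ realizes a tournament $T$ on $\{1,\dots,n\}$ if for all distinct $i,j$: $X_i \succeq X_j$ if and only if there is an edge from $i$ to $j$ in $T$. *)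

(* Defs.v *)
From mathcomp Require Import all_boot all_order all_algebra.

Set Implicit Arguments.
Unset Strict Implicit.
Unset Printing Implicit Defensive.

Import Order.TTheory GRing.Theory Num.Theory.
Local Open Scope ring_scope.

(* The vertices 1, ..., n are represented by 'I_n = {0, ..., n-1};
   [e i j] means that there is an edge from i to j. *)
Definition tournament (n : nat) (e : rel 'I_n) : Prop :=
  (forall i, ~~ e i i) /\
  (forall i j, i != j -> (e i j || e j i) && ~~ (e i j && e j i)).

(* The faces are listed in a tuple, so repeated faces are allowed and count
   with multiplicity; R is any totally ordered domain of numbers
   (integers, rationals, reals, ...). *)
Definition die (R : realDomainType) (k : nat) := k.-tuple R.

(* The pairs of faces are counted through pairs of positions; the probability
   is a rational number whatever the domain of the faces. *)
Definition win_prob (R : realDomainType) (k : nat) (X Y : die R k) : rat :=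
  #|[set ab : 'I_k * 'I_k | tnth Y ab.2 < tnth X ab.1]|%:R / (k ^ 2)%N%:R.

Definition beats (R : realDomainType) (k : nat) (X Y : die R k) : Prop :=
  1 / 2%:R < win_prob X Y.

Definition realizes (R : realDomainType) (n k : nat)
    (X : 'I_n -> die R k) (e : rel 'I_n) : Prop :=
  forall i j, i != j -> (beats (X i) (X j) <-> e i j).

(* Main.v *)
Require Import Defs.
From mathcomp Require Import all_boot all_order all_algebra.
From mathcomp Require Import zify.

(** Let [N] be the (odd) number of sides.  Split the faces into [N] levels, each
    die having one face per level, so that comparisons across levels cancel and
    a duel is decided by the majority of the [N] comparisons inside a level.
    Place the vertices on the cycle Z/N, plus possibly a vertex at infinity (the
    number [N]).  At level [a], faces are ordered by the circular distance of
    the vertex to [a], except that [a] and infinity sit together between the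
    distances [N/4] and [N/4 + 1]; the pairs [{a - t, a + t}] and [{a, N}] are
    the only ties, and they are broken by the tournament.  A pair [i, j] in the
    cycle is tied at the level [c = (i + j)/2] only, and the reflection around
    [c] exchanges [i] and [j], so the other levels cancel.  A pair [j, infinity]
    is tied at level [j], and when [N = 1 mod 4] exactly half of the other
    levels are at distance at most [N/4] from [j]. *)

Set Implicit Arguments.
Unset Strict Implicit.
Unset Printing Implicit Defensive.

Import Order.TTheory GRing.Theory Num.Theory.

(** [W] and its preimage under [f] have equal size, cover [P], and overlap at [x]. *)
Lemma half_lt_card (P : finType) (W : {set P}) (f : P -> P) (x : P) :
    injective f -> (forall p, (p \in W) || (f p \in W)) ->
    x \in W -> f x \in W ->
  #|P| < 2 * #|W|.
Proof.
move=> f_inj Wf Wx Wfx.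
have -> : 2 * #|W| = #|W| + #|f @^-1: W|.
  by rewrite card_preimset // mul2n addnn.
rewrite -cardsUI.
have -> : W :|: f @^-1: W = setT by apply/setP=> p; rewrite !inE Wf.
rewrite cardsT -[X in X < _]addn0 ltn_add2l card_gt0.
by apply/set0Pn; exists x; rewrite !inE Wx.
Qed.

Definition wins (R : realDomainType) k (X Y : die R k) : {set 'I_k * 'I_k} :=
  [set ab | (tnth Y ab.2 < tnth X ab.1)%R].

Lemma beatsE (R : realDomainType) k (X Y : die R k) : 0 < k ->
  beats X Y <-> k ^ 2 < 2 * #|wins X Y|.
Proof.
move=> k_gt0; rewrite /beats /win_prob -/(wins X Y).
rewrite ltr_pdivlMr ?ltr0n ?expn_gt0 ?k_gt0 //.
rewrite mul1r mulrC ltr_pdivrMr ?ltr0n // -natrM ltr_nat mulnC.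
by [].
Qed.

Lemma beats_asym (R : realDomainType) k (X Y : die R k) : 0 < k -> beats X Y -> ~ beats Y X.
Proof.
move=> k_gt0 /(beatsE _ _ k_gt0) XY /(beatsE _ _ k_gt0) YX.
pose swap (ab : 'I_k * 'I_k) := (ab.2, ab.1).
have swapK : involutive swap by case.
have := cardsUI (wins X Y) (swap @^-1: wins Y X).
rewrite (card_preimset _ (inv_inj swapK)).
have -> : wins X Y :&: swap @^-1: wins Y X = set0.
  by apply/setP=> ab; rewrite !inE /=; case: ltgtP.
have := subset_leq_card (subsetT (wins X Y :|: swap @^-1: wins Y X)).
rewrite cardsT card_prod card_ord mulnn cards0.
set z := #|_| in XY *; set y := #|_| in YX *; set u := #|_|.
lia.
Qed.

(** When [v] stays below [B], the multiples of [B] keep the levels apart, and [v] only matters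
    inside a level. *)
Definition level_die (R : realDomainType) (v : nat -> nat) (k B : nat) : die R k :=
  [tuple ((a * B + v a)%:R)%R | a < k].

Lemma level_die_beats (R : realDomainType) (v w : nat -> nat) (k B : nat)
    (s : nat -> nat) (c : nat) :
    (forall a, a < k -> v a < B) -> (forall a, a < k -> w a < B) ->
    (forall a, a < k -> s a < k) ->
    (forall a b, a < k -> b < k -> s a = s b -> a = b) ->
    (forall a, a < k -> (w a < v a) || (w (s a) < v (s a))) ->
    c < k -> s c = c -> w c < v c ->
  beats (level_die R v k B) (level_die R w k B).
Proof.
move=> vB wB sk s_inj s_win ck sc win_c.
apply/beatsE; first by apply: leq_trans ck.
have -> : k ^ 2 = #|{: 'I_k * 'I_k}| by rewrite card_prod card_ord mulnn.
pose t (a : 'I_k) := Ordinal (sk a (ltn_ord a)).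
(* Exchanging the two levels of a cross-level pair exchanges win and loss. *)
pose f (ab : 'I_k * 'I_k) :=
  if ab.1 == ab.2 then (t ab.1, t ab.1) else (ab.2, ab.1).
have winE a b : ((a, b) \in wins (level_die R v k B) (level_die R w k B)) =
    (b * B + w b < a * B + v a).
  by rewrite inE !tnth_mktuple ltr_nat.
have f_inj : injective f.
  move=> [a b] [a' b']; rewrite /f /=.
  have [<-|ab] := eqVneq a b; have [<-|ab'] := eqVneq a' b'.
  - by case=> /s_inj H; have -> : a = a' by apply: val_inj; apply: H.
  - by move=> [H1 H2]; case/eqP: ab'; rewrite -H1 -H2.
  - by move=> [H1 H2]; case/eqP: ab; rewrite H1 H2.
  - by move=> [-> ->].
apply: (half_lt_card (x := (Ordinal ck, Ordinal ck)) f_inj).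
- move=> [a b]; rewrite /f /=; have [<-|ab] := eqVneq a b.
    rewrite !winE !ltn_add2l; exact: s_win.
  have ab' : (a : nat) != b := ab.
  rewrite !winE.
  have := vB _ (ltn_ord a); have := wB _ (ltn_ord a).
  have := vB _ (ltn_ord b); have := wB _ (ltn_ord b); nia.
- by rewrite winE ltn_add2l.
- by rewrite /f eqxx winE /= sc ltn_add2l.
Qed.

(* The vertex [N] at infinity is given distance 0, like the vertex [a] with which
   it is tied at level [a]. *)
Definition cycle_dist (N i a : nat) : nat :=
  if i == N then 0 else minn (maxn i a - minn i a) (N - (maxn i a - minn i a)).

(** Distances beyond [N %/ 4] move up by one, freeing a slot for distance 0. *)
Definition dist_pos (N d : nat) : nat :=
  if d == 0 then (N %/ 4).+1 else if d <= N %/ 4 then d else d.+1.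

Definition level_pos (N i a : nat) : nat := dist_pos N (cycle_dist N i a).

Lemma dist_pos_inj (N : nat) : injective (dist_pos N).
Proof. by move=> d d'; rewrite /dist_pos; do 4?[case: ifP => ?]; lia. Qed.

Lemma cycle_distE (N i a : nat) : i < N ->
  cycle_dist N i a = minn (maxn i a - minn i a) (N - (maxn i a - minn i a)).
Proof. by move=> iN; rewrite /cycle_dist ltn_eqF. Qed.

(* The vertex tied with [i] at level [a]. *)
Definition partner (N i a : nat) : nat :=
  if i == N then a
  else if i == a then N
  else if 2 * a < i then 2 * a + N - i
  else if 2 * a < i + N then 2 * a - i
  else 2 * a - i - N.

(** Doubling leaves room for a tie-breaking bit that cannot reverse a strict comparison of
    positions. *)
Definition face_val (e : rel nat) (N i a : nat) : nat :=
  2 * level_pos N i a + e i (partner N i a).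

Lemma face_val_lt (e : rel nat) (N i a : nat) :
  a < N -> i <= N -> face_val e N i a < N + 4.
Proof.
move=> aN iN.
(* So a shifted position is at most [N./2 + 1], and its face value at most [N + 3]. *)
have d_le : 2 * cycle_dist N i a <= N by rewrite /cycle_dist; case: ifP => _; lia.
rewrite /face_val /level_pos /dist_pos.
by case: (e _ _) => /=; do 2?[case: ifP => _]; lia.
Qed.

(** The levels other than [c] cancel in pairs under [s]; at [c] the positions tie, and the bits
    compared are [e i j] and [e j i]. *)
Definition reflects (N i j : nat) (s : nat -> nat) (c : nat) : Prop :=
  [/\ forall a, a < N -> s a < N /\ s (s a) = a,
      forall a, a < N -> a <> c ->
        (level_pos N i a < level_pos N j a /\
         level_pos N j (s a) < level_pos N i (s a)) \/
        (level_pos N j a < level_pos N i a /\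
         level_pos N i (s a) < level_pos N j (s a)),
      c < N /\ s c = c,
      level_pos N i c = level_pos N j c &
      partner N i c = j /\ partner N j c = i].

Lemma reflectsC (N i j : nat) s c : reflects N i j s c -> reflects N j i s c.
Proof.
case=> H1 H2 H3 H4 [H5 H6]; split=> // a aN ac.
by case: (H2 a aN ac) => [[? ?]|[? ?]]; [right|left].
Qed.

Lemma reflects_cycle (N i j : nat) : odd N -> i < N -> j < N -> i <> j ->
  exists s c, reflects N i j s c.
Proof.
move=> oN iN jN ij.
(* The reflection [i + j - a] modulo [N]. *)
pose s a := if i + j < a then i + j + N - a
            else if i + j < a + N then i + j - a else i + j - a - N.
have sN a : a < N -> s a < N by rewrite /s; do 2?[case: ifP => ?]; lia.
have sE a : a < N ->
    [\/ s a + a = i + j, s a + a = i + j + N | s a + a + N = i + j].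
  rewrite /s; case: ifP => ?; last case: ifP => ?.
  - by constructor 2; lia.
  - by constructor 1; lia.
  - by constructor 3; lia.
have sK a : a < N -> s (s a) = a.
  move=> aN; have := sN _ (sN _ aN).
  by case: (sE _ aN) => ?; case: (sE _ (sN _ aN)) => ?; lia.
have dist_s a : a < N -> cycle_dist N i (s a) = cycle_dist N j a.
  by move=> aN; rewrite !cycle_distE // /s; do 2?[case: ifP => ?]; lia.
(* Since [N] is odd, [i + j] has a unique half modulo [N]. *)
have [c [cN cE]] : exists c, c < N /\
    [\/ 2 * c = i + j, 2 * c = i + j + N | 2 * c + N = i + j].
  have [oij|eij] := boolP (odd (i + j)).
    have [ijN|ijN] := ltnP (i + j) N.
      by exists (i + j + N)./2; split; [lia | constructor 2; lia].
    by exists (i + j - N)./2; split; [lia | constructor 3; lia].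
  by exists (i + j)./2; split; [lia | constructor 1; lia].
have sc : s c = c by case: cE => ?; rewrite /s; do 2?[case: ifP => ?]; lia.
have dist_ne a : a < N -> a <> c -> cycle_dist N i a <> cycle_dist N j a.
  by move=> aN ac; rewrite !cycle_distE //; case: cE => ?; lia.
exists s, c; split=> [a aN|a aN ac||//|].
- by split; [exact: sN | exact: sK].
- rewrite /level_pos dist_s // -(dist_s (s a)) ?sN // sK //.
  case: (ltngtP (dist_pos N (cycle_dist N i a))) => [||/dist_pos_inj].
  + by left.
  + by right.
  + by move/dist_ne; case.
- by [].
- by rewrite /level_pos -dist_s // sc.
- by split; rewrite /partner ltn_eqF //; case: cE => ?;
    do 3?[case: ifP => ?]; lia.
Qed.

Lemma reflects_infinity (N j : nat) : N %% 4 = 1 -> j < N ->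
  exists s c, reflects N N j s c.
Proof.
move=> N1 jN.
have [q Nq] : exists q, N = 4 * q + 1 by exists (N %/ 4); lia.
have N4 : N %/ 4 = q by lia.
pose to a := if j <= a then a - j else a + N - j.
pose fro t := if j + t < N then j + t else j + t - N.
(* On the offset [t = a - j] modulo [N], each of the two sides of [j] is reversed separately. This
   turns distance [d] into [2 * q + 1 - d], exchanging the distances up to [q] with those above
   [q]. *)
pose flip (t : nat) := if t == 0 then 0 else
  if t <= 2 * q then 2 * q + 1 - t else 6 * q + 1 - t.
have toN a : a < N -> to a < N by rewrite /to; case: ifP => ?; lia.
have froN t : t < N -> fro t < N by rewrite /fro; case: ifP => ?; lia.
have flipN t : t < N -> flip t < N.
  by rewrite /flip; do 2?[case: ifP => ?]; lia.
have toK a : a < N -> fro (to a) = a.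
  by move=> aN; rewrite /to; case: ifP => ?; rewrite /fro; case: ifP => ?; lia.
have froK t : t < N -> to (fro t) = t.
  by move=> tN; rewrite /fro; case: ifP => ?; rewrite /to; case: ifP => ?; lia.
have flipK t : t < N -> flip (flip t) = t.
  by move=> tN; rewrite {2}/flip; do 2?[case: ifP => ?];
    rewrite /flip /=; do 2?[case: ifP => ?]; lia.
have distE a : a < N -> cycle_dist N j a = minn (to a) (N - to a).
  by move=> aN; rewrite cycle_distE // /to; case: ifP => ?; lia.
have dist_gt0 a : a < N -> a <> j -> 0 < cycle_dist N j a <= 2 * q.
  by move=> aN aj; rewrite cycle_distE //; lia.
pose s a := fro (flip (to a)).
have sN a : a < N -> s a < N by move=> aN; rewrite froN // flipN // toN.
have dist_s a : a < N -> a <> j ->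
    cycle_dist N j (s a) = 2 * q + 1 - cycle_dist N j a.
  move=> aN aj; have := dist_gt0 a aN aj; have := toN a aN.
  rewrite !distE ?sN // /s froK ?flipN ?toN // /flip.
  by do 2?[case: ifP => ?]; lia.
have posN a : level_pos N N a = q.+1 by rewrite /level_pos /cycle_dist eqxx /dist_pos N4.
exists s, j; split=> [a aN|a aN aj|||].
- by split; [exact: sN | rewrite /s froK ?flipN ?toN // flipK ?toN // toK].
- have := dist_gt0 a aN aj; rewrite !posN /level_pos dist_s //.
  rewrite /dist_pos N4 => ?.
  by do 4?[case: ifP => ?]; lia.
- by rewrite /s /to leqnn subnn /flip /fro /= addn0 jN.
- by rewrite posN /level_pos cycle_distE // maxnn minnn subnn min0n /dist_pos N4.
- by rewrite /partner !eqxx ltn_eqF.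
Qed.

Lemma reflects_exists (N i j : nat) : odd N -> i <= N -> j <= N -> i <> j ->
    N %% 4 = 1 \/ (i < N /\ j < N) ->
  exists s c, reflects N i j s c.
Proof.
move=> oN iN jN ij H.
have [iN'|iN'] := ltnP i N; have [jN'|jN'] := ltnP j N.
- exact: reflects_cycle.
- have -> : j = N by lia.
  have [||s [c /reflectsC rs]] := @reflects_infinity N i; [lia|lia|].
  by exists s, c.
- have -> : i = N by lia.
  by apply: reflects_infinity; lia.
- lia.
Qed.

Lemma face_val_beats (R : realDomainType) (e : rel nat) (N i j : nat) :
    odd N -> i <= N -> j <= N -> i <> j ->
    N %% 4 = 1 \/ (i < N /\ j < N) -> e i j -> ~~ e j i ->
  beats (level_die R (face_val e N i) N (N + 4))
        (level_die R (face_val e N j) N (N + 4)).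
Proof.
move=> oN iN jN ij H eij eji.
have [s [c [sK s_pos [cN sc] pos_c [pi pj]]]] := reflects_exists oN iN jN ij H.
have win_c : face_val e N j c < face_val e N i c.
  by rewrite /face_val pi pj pos_c eij (negbTE eji) ltn_add2l.
apply: (@level_die_beats _ _ _ _ _ s c) => //.
- by move=> a aN; apply: face_val_lt.
- by move=> a aN; apply: face_val_lt.
- by move=> a /sK[].
- by move=> a b /sK[_ {2}<-] /sK[_ {2}<-] ->.
- move=> a aN; have [->|ac] := eqVneq a c; first by rewrite win_c.
  have := s_pos a aN (elimN eqP ac); rewrite /face_val.
  by do 4![case: (e _ _)] => /=; lia.
Qed.

Lemma tournament_realizable (R : realDomainType) (n N : nat) (T : rel 'I_n) :
    tournament T -> odd N -> n <= N \/ (N %% 4 = 1 /\ n <= N.+1) ->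
  exists X : 'I_n -> die R N, realizes X T.
Proof.
move=> [_ hT] oN nN.
(* Partners may fall outside the [n] vertices, so [T] is extended by false. *)
pose e : rel nat := fun x y =>
  [exists i : 'I_n, exists j : 'I_n, [&& val i == x, val j == y & T i j]].
have eE (i j : 'I_n) : e i j = T i j.
  apply/existsP/idP => [[i' /existsP[j' /and3P[/eqP/val_inj-> /eqP/val_inj->]]]|Tij] //.
  by exists i; apply/existsP; exists j; rewrite !eqxx.
exists (fun i => level_die R (face_val e N i) N (N + 4)).
have T_beats (i j : 'I_n) : i != j -> T i j ->
    beats (level_die R (face_val e N i) N (N + 4))
          (level_die R (face_val e N j) N (N + 4)).
  move=> ij Tij; have ij' : (i : nat) != j := ij.
  have [iN jN] := (ltn_ord i, ltn_ord j).
  apply: face_val_beats; rewrite ?eE //; try lia.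
  by have /andP[_] := hT i j ij; rewrite Tij.
move=> i j ij; split; last exact: T_beats.
(* Without the edge from [i] to [j], die [j] would beat die [i], and two dice cannot beat each
   other. *)
have /andP[/orP[//|Tji] _] := hT i j ij.
have := T_beats j i; rewrite eq_sym => /(_ ij Tji) /beats_asym ji /ji[].
exact: odd_gt0.
Qed.

Theorem theorem3 (R : realDomainType) (n : nat) (T : rel 'I_n)
    (hT : tournament T) :
  (odd n -> exists X : 'I_n -> die R n, realizes X T) /\
  (4 %| n -> exists X : 'I_n -> die R (n + 1), realizes X T) /\
  (~~ odd n -> ~~ (4 %| n) -> exists X : 'I_n -> die R (n - 1), realizes X T).
Proof.
split=> [on|]; last split=> [n4|en n4].
- by apply: tournament_realizable => //; left.
- by apply: tournament_realizable => //; lia.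
(* Here [n] is 2 modulo 4, so [N = n - 1] is 1 modulo 4 and the last vertex sits at infinity. *)
- by apply: tournament_realizable => //; lia.
Qed.
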